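(* Let $\varepsilon\in (0,1]$, $q\in (2,\infty)$, $d\in\mathbb{N}$, and let $a\in C(\mathbb{R},\mathbb{R})$ satisfy for all $x\in \mathbb{R}$ that $a(x)=\max\{x,0\}$. Then there exists $\Phi\in \mathbf{N}$ such that (i) $\mathcal{R}_a (\Phi)\in C(\mathbb{R}^{d+1},\mathbb{R}^d)$; (ii) for all $t\in\mathbb{R}$, $x\in\mathbb{R}^d$: $(\mathcal{R}_a (\Phi))(t,0)=(\mathcal{R}_a (\Phi))(0,x)=0$; (iii) for all $t\in\mathbb{R}$, $x\in\mathbb{R}^d$: $\Vert t x-(\mathcal{R}_a (\Phi))(t,x)\Vert\le \varepsilon \big(\sqrt{d}\,\max\{1,|t|^q\}+\Vert x\Vert^q\big)$; (iv) for all $t\in\mathbb{R}$, $x\in\mathbb{R}^d$: $\Vert (\mathcal{R}_a (\Phi))(t,x)\Vert\le \sqrt{d}(1+2 t^2)+2\Vert x\Vert^2$; (v) $\mathcal{P}(\Phi)\le d^2 \big[\tfrac{360q}{(q-2)}\big]\big[\log_2(\varepsilon^{-1})+q+1\big]-252d^2$; and (vi) $\mathcal{L}(\Phi)\le \tfrac{q}{(q-2)}[\log_2(\varepsilon^{-1})+q]$.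
   Context: $\mathbb{N}=\{1,2,3,\dots\}$, $\Vert\cdot\Vert$ is the Euclidean norm. Artificial neural networks (ANNs): $\mathbf{N}=\cup_{L \in \mathbb{N}}\cup_{(l_0,\ldots, l_L) \in \mathbb{N}^{L+1}}\big(\times_{k = 1}^L (\mathbb{R}^{l_k \times l_{k-1}} \times \mathbb{R}^{l_k})\big)$. For $\Phi\in \times_{k = 1}^L (\mathbb{R}^{l_k \times l_{k-1}} \times \mathbb{R}^{l_k})$: number of parameters $\mathcal{P}(\Phi)=\sum_{k=1}^L l_k(l_{k-1}+1)$, length $\mathcal{L}(\Phi)=L$. Realization: for $a\in C(\mathbb{R},\mathbb{R})$, $L,l_0,l_1,\dots,l_L\in\mathbb{N}$, and $\Phi=((W_1,B_1),\dots,(W_L,B_L))\in \times_{k = 1}^L (\mathbb{R}^{l_k \times l_{k-1}} \times \mathbb{R}^{l_k})$, the function $\mathcal{R}_a(\Phi)\in C(\mathbb{R}^{l_0},\mathbb{R}^{l_L})$ is given by $(\mathcal{R}_a(\Phi))(x_0)=W_Lx_{L-1}+B_L$, where $x_k=\mathfrak{M}_{a,l_k}(W_kx_{k-1}+B_k)$ for $k\in\mathbb{N}\cap(0,L)$ and $\mathfrak{M}_{a,m}(x_1,\dots,x_m)=(a(x_1),\dots,a(x_m))$. *)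

(* Defs.v *)
From HB Require Import structures.
From mathcomp Require Import all_boot all_order all_algebra.
From mathcomp Require Import all_classical all_reals all_analysis.
Import Order.TTheory GRing.Theory Num.Theory.
Import numFieldNormedType.Exports.

Set Implicit Arguments.
Unset Strict Implicit.
Unset Printing Implicit Defensive.

Local Open Scope ring_scope.

(* [ann R m n] is the set of networks with l_0 = m and l_L = n.  The last
   affine map (W_L, B_L) is [ann_output W B]; [ann_hidden W B Phi] puts
   (W, B) in front of Phi, and is followed by an activation.  The positivity
   arguments make every l_k positive (a hidden width k is the input dimension
   of the tail). *)
Inductive ann (R : Type) : nat -> nat -> Type :=
| ann_output (m n : nat) of (0 < m)%N & (0 < n)%N &
    'M[R]_(n, m) & 'cV[R]_n : ann R m n
| ann_hidden (m k n : nat) of (0 < m)%N &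
    'M[R]_(k, m) & 'cV[R]_k & ann R k n : ann R m n.

Fixpoint ann_length (R : Type) (m n : nat) (Phi : ann R m n) : nat :=
  match Phi with
  | ann_output _ _ _ _ _ _ => 1%N
  | ann_hidden _ _ _ _ _ _ Psi => (ann_length Psi).+1
  end.

Fixpoint ann_nparams (R : Type) (m n : nat) (Phi : ann R m n) : nat :=
  match Phi with
  | ann_output m n _ _ _ _ => (n * (m + 1))%N
  | ann_hidden m k _ _ _ _ Psi => (k * (m + 1) + ann_nparams Psi)%N
  end.

Fixpoint ann_realization (R : realType) (a : R -> R) (m n : nat)
    (Phi : ann R m n) : 'cV[R]_m -> 'cV[R]_n :=
  match Phi with
  | ann_output _ _ _ _ W B => fun x => W *m x + B
  | ann_hidden _ _ _ _ W B Psi =>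
      fun x => ann_realization a Psi (map_mx a (W *m x + B))
  end.

(* The library norm on matrices is the sup norm. *)
Definition enorm (R : realType) (n : nat) (x : 'cV[R]_n) : R :=
  Num.sqrt (\sum_(i < n) x i 0 ^+ 2).

Definition vcons (R : realType) (d : nat) (t : R) (x : 'cV[R]_d) :
    'cV[R]_d.+1 :=
  col_mx (const_mx t : 'cV[R]_1) x.

Definition log2 (R : realType) (x : R) : R := ln x / ln 2.

(* Main.v *)
(* The product is polarised, t y = A^2 (v^2 - w^2) with v = (t + y) / (2A) and
   w = (t - y) / (2A), and v^2 is replaced by the convex piecewise linear
   function obtained from the self-similarity
     v^2 = |v| - 1/4 + (2|v| - 1)^2 / 4
   by unfolding k times and using |v| at the end: the error is at most 4^-(k+1)
   on [-1, 1], and outside [-1, 1] the approximant stays between 1 and v^2.  The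
   approximant is even, so the approximate product vanishes as soon as one factor
   does.  With A = eps^(-1/(q-2)) one has r^2 <= eps r^q for all r >= A, which
   absorbs the error outside the box, and k = floor (q/(q-2) log2 (1/eps)) steps
   suffice inside.  One hidden layer per step computes the absolute values, since
   p and |p| are linear in (relu p, relu (-p)). *)
Require Import Defs.
From HB Require Import structures.
From mathcomp Require Import all_boot all_order all_algebra.
From mathcomp Require Import all_classical all_reals all_analysis.
From mathcomp Require Import ring lra zify.
Import Order.TTheory GRing.Theory Num.Theory.
Import numFieldNormedType.Exports.

Set Implicit Arguments.
Unset Strict Implicit.
Unset Printing Implicit Defensive.

Local Open Scope ring_scope.

(** * Piecewise linear approximation of the square *)

Fixpoint sq_interp (R : realFieldType) (k : nat) (v : R) : R :=
  if k is j.+1 then `|v| - 4^-1 + sq_interp j (2 * `|v| - 1) / 4 else `|v|.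

(** With u = |v|, the base error u - u^2 = 1/4 - (u - 1/2)^2 is at most 1/4; each unfolding maps
    [-1, 1] into itself and divides the error by 4. *)
Lemma sq_interp_le1 (R : realFieldType) (k : nat) (v : R) : `|v| <= 1 ->
  v ^+ 2 <= sq_interp k v <= v ^+ 2 + (4 ^+ k.+1)^-1.
Proof.
elim: k v => [|k IH] v v1 /=.
  have ->: v ^+ 2 = `|v| ^+ 2 by rewrite real_normK ?num_real.
  have := normr_ge0 v; move: `|v| v1 => u *; rewrite expr1.
  apply/andP; split; first nra.
  by have := sqr_ge0 (u - 2^-1); nra.
have /IH/andP[] : `|2 * `|v| - 1| <= 1.
  by have := normr_ge0 v; rewrite ler_norml; lra.
have ->: v ^+ 2 = `|v| ^+ 2 by rewrite real_normK ?num_real.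
rewrite (exprS _ k.+1) invfM; set e := (4 ^+ k.+1)^-1.
move: (sq_interp k _) => s; move: `|v| => u *; lra.
Qed.

(** The map u -> 2u - 1 preserves [1, oo), and the self-similarity carries both bounds through the
    induction. *)
Lemma sq_interp_ge1 (R : realFieldType) (k : nat) (v : R) : 1 <= `|v| ->
  1 <= sq_interp k v <= v ^+ 2.
Proof.
elim: k v => [|k IH] v v1 /=; rewrite -(real_normK (num_real v)).
  by rewrite v1 /= expr2 ler_peMr.
have /IH/andP[] : 1 <= `|2 * `|v| - 1|.
  by apply: le_trans (ler_norm _); lra.
by move: (sq_interp k _) => s; move: `|v| v1 => u *; nra.
Qed.

(** The approximant is above the square inside [-1, 1] and below it outside. Errors of equal sign do
    not add up in the difference; in the mixed cases they do, but the outer one is at most the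
    square minus 1, which leaves room for the inner one. *)
Lemma sq_interp_sub (R : realFieldType) (k : nat) (v w : R) :
  `|v| <= 1 /\ `|w| <= 1 /\
  `|v ^+ 2 - w ^+ 2 - (sq_interp k v - sq_interp k w)| <= (4 ^+ k.+1)^-1 \/
  (1 < `|v| \/ 1 < `|w|) /\
  `|v ^+ 2 - w ^+ 2 - (sq_interp k v - sq_interp k w)|
    <= Num.max (v ^+ 2) (w ^+ 2).
Proof.
have e4 : (4 ^+ k.+1)^-1 <= 4^-1 :> R.
  rewrite lef_pV2 ?posrE ?exprn_gt0 // exprS ler_peMr ?exprn_ege1 //; lra.
have e0 : 0 < (4 ^+ k.+1)^-1 :> R by rewrite invr_gt0 exprn_gt0.
move: (@sq_interp_le1 _ k v) (@sq_interp_ge1 _ k v).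
move: (@sq_interp_le1 _ k w) (@sq_interp_ge1 _ k w).
have := sqr_ge0 v; have := sqr_ge0 w.
have: 1 < `|v| -> 1 <= v ^+ 2.
  by move=> h; rewrite -(real_normK (num_real v)) exprn_ege1 // ltW.
have: 1 < `|w| -> 1 <= w ^+ 2.
  by move=> h; rewrite -(real_normK (num_real w)) exprn_ege1 // ltW.
have vM : v ^+ 2 <= Num.max (v ^+ 2) (w ^+ 2) by rewrite le_max lexx.
have wM : w ^+ 2 <= Num.max (v ^+ 2) (w ^+ 2) by rewrite le_max lexx orbT.
move: vM wM; move: (Num.max _ _) (sq_interp k v) (sq_interp k w) => m s s'.
move: e4 e0; move: (4 ^+ k.+1)^-1 (v ^+ 2) (w ^+ 2) => e v2 w2.
case: (lerP `|v| 1) => hv; case: (lerP `|w| 1) => hw e4 e0 vM wM Hw Hv w0 v0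
  sw1 sw2 sv1 sv2.
- left; do 2!split=> //; have := sw1 isT; have := sv1 isT.
  by rewrite ler_norml; lra.
- right; split; first by right.
  have := sv1 isT; have := sw2 (ltW hw); have := Hw isT; rewrite ler_norml; lra.
- right; split; first by left.
  have := sw1 isT; have := sv2 (ltW hv); have := Hv isT; rewrite ler_norml; lra.
- right; split; first by left.
  have := sw2 (ltW hw); have := sv2 (ltW hv).
  have := Hv isT; have := Hw isT; rewrite ler_norml; lra.
Qed.

(** * The approximate product of two numbers *)

Definition approx_mul (R : realFieldType) (k : nat) (A t y : R) : R :=
  A ^+ 2 * (sq_interp k ((2 * A)^-1 * (t + y)) -
            sq_interp k ((2 * A)^-1 * (t - y))).

Lemma sq_interpN (R : realFieldType) (k : nat) (v : R) :
  sq_interp k (- v) = sq_interp k v.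
Proof. by case: k => [|k] /=; rewrite normrN. Qed.

Lemma approx_mul0r (R : realFieldType) (k : nat) (A t : R) :
  approx_mul k A t 0 = 0.
Proof. by rewrite /approx_mul subr0 addr0 subrr mulr0. Qed.

Lemma approx_mul0l (R : realFieldType) (k : nat) (A y : R) :
  approx_mul k A 0 y = 0.
Proof. by rewrite /approx_mul !add0r mulrN sq_interpN subrr mulr0. Qed.

(** Both A |v| and A |w| are at most r = max(|t|, |y|), so leaving the box forces A <= r, and A^2
    max(v^2, w^2) <= r^2. *)
Lemma approx_mulP (R : realFieldType) (k : nat) (A t y : R) : 0 < A ->
  `|t * y - approx_mul k A t y| <= A ^+ 2 / 4 ^+ k.+1 \/
  A <= Num.max `|t| `|y| /\
  `|t * y - approx_mul k A t y| <= Num.max `|t| `|y| ^+ 2.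
Proof.
move=> A0; set v := (2 * A)^-1 * (t + y); set w := (2 * A)^-1 * (t - y).
have ->: t * y - approx_mul k A t y =
    A ^+ 2 * (v ^+ 2 - w ^+ 2 - (sq_interp k v - sq_interp k w)).
  by rewrite /approx_mul -/v -/w [RHS]mulrBr /v /w; congr (_ - _); field; lra.
rewrite normrM (ger0_norm (sqr_ge0 A)).
set r := Num.max `|t| `|y|.
have rt : `|t| <= r by rewrite le_max lexx.
have ry : `|y| <= r by rewrite le_max lexx orbT.
have A2 : 0 < (2 * A)^-1 by rewrite invr_gt0; lra.
have vr : A * `|v| <= r.
  rewrite normrM gtr0_norm //; have := ler_normD t y.
  have ->: A * ((2 * A)^-1 * `|t + y|) = `|t + y| / 2 by field; lra.
  by move: `|t + y| => u; lra.
have wr : A * `|w| <= r.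
  rewrite normrM gtr0_norm //; have := ler_normB t y.
  have ->: A * ((2 * A)^-1 * `|t - y|) = `|t - y| / 2 by field; lra.
  by move: `|t - y| => u; lra.
have [[_ [_ h]]|[h1 h2]] := sq_interp_sub k v w.
  by left; rewrite ler_pM2l // exprn_gt0.
right; split.
  by case: h1 => h1; [apply: le_trans vr|apply: le_trans wr];
    rewrite ler_peMr ?(ltW A0) ?(ltW h1).
apply: le_trans (ler_wpM2l (sqr_ge0 A) h2) _.
rewrite maxr_pMr ?sqr_ge0 // ge_max -!exprMn.
rewrite -(real_normK (num_real (A * v))) -(real_normK (num_real (A * w))).
rewrite !(normrM A) !(gtr0_norm A0) !lerXn2r ?nnegrE //.
all: by rewrite ?mulr_ge0 ?(ltW A0) ?(le_trans _ rt).
Qed.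

(** * Continuity of realizations *)

Lemma continuous_mx (T : topologicalType) (U : topologicalType) (m n : nat)
    (f : T -> 'M[U]_(m, n)) :
  (forall i j, continuous (fun x => f x i j)) -> continuous f.
Proof.
move=> fc x A [P /= fxP PA];
apply: (@filterS _ _ _ (fun y => forall i j, P i j (f y i j))).
  by move=> y Py; apply: PA.
apply: filter_forall => i; apply: filter_forall => j.
exact: (fc i j x _ (fxP i j)).
Qed.

Lemma ann_realization_continuous (R : realType) (a : R -> R) (m n : nat)
    (Phi : ann R m n) : continuous a -> continuous (ann_realization a Phi).
Proof.
have affine (p r : nat) (W : 'M[R]_(r, p)) (B : 'cV[R]_r) i :
    continuous (fun x : 'cV[R]_p => (W *m x + B) i 0).
  have -> : (fun x : 'cV[R]_p => (W *m x + B) i 0) =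
      (fun x => \sum_j W i j * x j 0 + B i 0).
    by apply/funext => x; rewrite !mxE.
  move=> x.
  apply: (@continuousD _ _ _ (fun x : 'cV[R]_p => \sum_j W i j * x j 0)
    (fun=> B i 0) x).
    rewrite /prop_for /continuous_at.
    apply: (@cvg_big _ _ _ _ _ _ _ (nbhs x) _
      (fun j (x : 'cV[R]_p) => W i j * x j 0)) => [|j _].
      exact: add_continuous.
    apply: (@cvgM _ _ (nbhs x) _ (fun=> W i j) (fun x : 'cV[R]_p => x j 0)).
      exact: cvg_cst.
    exact: coord_continuous.
  exact: cst_continuous.
move=> ac; elim: Phi => {m n} /= [m n _ _ W B|m k n _ W B Psi IH].
  by apply: continuous_mx => i j; rewrite ord1; apply: affine.
move=> x.
apply: (@continuous_comp _ _ _ (fun x : 'cV[R]_m => map_mx a (W *m x + B)));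
  last exact: IH.
apply: continuous_mx => i j y; rewrite ord1.
under eq_fun do rewrite mxE.
exact: (@continuous_comp _ _ _ (fun z : 'cV[R]_m => (W *m z + B) i 0)
  a y (affine _ _ W B i y) (ac _)).
Qed.

(** * From coordinatewise bounds to the Euclidean norm *)

Lemma enorm_le (R : realType) (d : nat) (e b : 'cV[R]_d) (M : R) :
  (0 < d)%N -> 0 <= M -> (forall i, 0 <= b i 0) ->
  (forall i, `|e i 0| <= M + b i 0) ->
  enorm e <= Num.sqrt d%:R * M + \sum_i b i 0.
Proof.
move=> d0 M0 b0 eb; set S := \sum_i b i 0; have S0 : 0 <= S by apply: sumr_ge0.
have sd : 1 <= Num.sqrt d%:R :> R.
  by rewrite -[leLHS]sqrtr1 ler_wsqrtr // ler1n.
have sd2 : Num.sqrt d%:R ^+ 2 = d%:R :> R by rewrite sqr_sqrtr.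
have T0 : 0 <= Num.sqrt d%:R * M + S.
  by rewrite addr_ge0 // mulr_ge0 // (le_trans ler01).
rewrite -(ger0_norm T0) -sqrtr_sqr ler_wsqrtr //.
(* Each [b i 0] is at most S, so the squares sum to at most d M^2 + 2 M S + S^2; the target square
   exceeds this by 2 (sqrt d - 1) M S. *)
apply: (@le_trans _ _ (\sum_i (M ^+ 2 + 2 * M * b i 0 + b i 0 * S))).
  apply: ler_sum => i _; rewrite -(real_normK (num_real (e i 0))).
  have bS : b i 0 <= S.
    by rewrite /S (bigD1 i) //= lerDl; apply: sumr_ge0.
  have := eb i; have := normr_ge0 (e i 0); have := b0 i.
  move: bS; move: (b i 0) `|_| => u v *; nra.
rewrite !big_split /= sumr_const card_ord -mulr_sumr -mulr_suml -/S.
rewrite -[M ^+ 2 *+ d]mulr_natl; move: S0 sd sd2.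
move: (Num.sqrt _) => s; move: (d%:R : R) => D Sge0 s1 <-.
have : 0 <= (s - 1) * (M * S) by rewrite mulr_ge0 ?subr_ge0 ?mulr_ge0.
nra.
Qed.

Lemma sqr_enorm (R : realType) (d : nat) (x : 'cV[R]_d) :
  enorm x ^+ 2 = \sum_i x i 0 ^+ 2.
Proof. by rewrite sqr_sqrtr // sumr_ge0 // => i _; apply: sqr_ge0. Qed.

Lemma powR_split2 (R : realType) (q x : R) : 2 < q -> 0 <= x ->
  x `^ q = x `^ (q - 2) * x ^+ 2.
Proof.
move=> q2 x0; have -> : x ^+ 2 = x `^ 2%:R by rewrite powR_mulrn.
rewrite -powRD ?subrK //; apply/implyP; lra.
Qed.

(** Only q - 2 of the q factors are enlarged from |x_i| to the norm; the remaining squares sum to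
    the squared norm. *)
Lemma sum_powR_le (R : realType) (d : nat) (q : R) (x : 'cV[R]_d) : 2 < q ->
  \sum_i `|x i 0| `^ q <= enorm x `^ q.
Proof.
move=> q2; rewrite [leRHS]powR_split2 ?sqrtr_ge0 // sqr_enorm mulr_sumr.
apply: ler_sum => i _; rewrite powR_split2 // real_normK ?num_real //.
rewrite ler_wpM2r ?sqr_ge0 // ge0_ler_powR ?nnegrE ?sqrtr_ge0 //; first lra.
rewrite -sqrtr_sqr ler_wsqrtr // (bigD1 i) //= lerDl.
by apply: sumr_ge0 => j _; apply: sqr_ge0.
Qed.

(** * The network, its realization and its size *)

Definition split_mx (R : realType) (n : nat) : 'M[R]_(n + n, n) :=
  col_mx 1%:M (- 1%:M).

(** Coefficients of G p + H |p| in the pair (relu p, relu (-p)), whose difference is p and whose sum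
    is |p|. *)
Definition read_mx (R : realType) (n m : nat) (G H : 'M[R]_(m, n)) :
    'M[R]_(m, n + n) := row_mx (G + H) (H - G).

Lemma read_mxP (R : realType) (a : R -> R) (n m : nat) (G H : 'M[R]_(m, n))
    (p : 'cV[R]_n) : (forall x, a x = Num.max x 0) ->
  read_mx G H *m map_mx a (split_mx R n *m p) = G *m p + H *m map_mx Num.norm p.
Proof.
move=> aE; rewrite mul_col_mx mul1mx mulNmx mul1mx map_col_mx mul_row_col.
rewrite !(mulmxDl, mulNmx) [X in _ + X]addrC addrACA -mulmxBr -mulmxDr.
congr (_ + _); congr (_ *m _); apply/matrixP => i j; rewrite !mxE !aE.
  by case: (lerP (p i j) 0); case: (lerP (- p i j) 0); lra.
by case: (ler0P (p i j)); case: (lerP (- p i j) 0); lra.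
Qed.

Lemma split_width_gt0 (d : nat) :
  (0 < d)%N -> (0 < (d + d + d) + (d + d + d))%N.
Proof. by move=> d_gt0; rewrite !addn_gt0 d_gt0. Qed.

(* [lin_step], [abs_step] and [const_step] describe one step
   (v, w, s) |-> (2|v| - 1, 2|w| - 1, 4 (s + |v| - |w|)); the factor 4 in the
   accumulator s is undone by g / 4 in [mul_net_tail], which keeps the weights
   independent of the layer. *)
Definition lin_step (R : realType) (d : nat) : 'M[R]_(d + d + d) :=
  block_mx 0 0 0 4%:M.
Definition abs_step (R : realType) (d : nat) : 'M[R]_(d + d + d) :=
  block_mx 2%:M 0 (row_mx 4%:M (- 4%:M)) 0.
Definition const_step (R : realType) (d : nat) : 'cV[R]_(d + d + d) :=
  col_mx (const_mx (-1)) 0.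

(** The input is the activated split of a state (v, w, s). Reading it, making one step and splitting
    again compose to a single affine map, hence one layer per step. *)
Fixpoint mul_net_tail (R : realType) (d : nat) (d_gt0 : (0 < d)%N)
    (k : nat) (g : R) :
    ann R ((d + d + d) + (d + d + d)) d :=
  if k is j.+1 then
    ann_hidden (split_width_gt0 d_gt0)
      (split_mx R (d + d + d) *m read_mx (lin_step R d) (abs_step R d))
      (split_mx R (d + d + d) *m const_step R d) (mul_net_tail d_gt0 j (g / 4))
  else
    ann_output (split_width_gt0 d_gt0) d_gt0
      (g *: read_mx (row_mx 0 1%:M) (row_mx (row_mx 1%:M (- 1%:M)) 0)) 0.

Definition polar_mx (R : realType) (d : nat) (c : R) :
    'M[R]_(d + d + d, 1 + d) :=
  col_mx (col_mx (row_mx (const_mx c) c%:M) (row_mx (const_mx c) (- c%:M))) 0.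

Definition mul_net (R : realType) (d : nat) (d_gt0 : (0 < d)%N)
    (k : nat) (A : R) : ann R d.+1 d :=
  ann_hidden (ltn0Sn d) (split_mx R (d + d + d) *m polar_mx d (2 * A)^-1) 0
    (mul_net_tail d_gt0 k (A ^+ 2)).

Lemma polar_mxE (R : realType) (d : nat) (c t : R) (x : 'cV[R]_d) :
  polar_mx d c *m vcons t x =
  col_mx (col_mx (c *: (const_mx t + x)) (c *: (const_mx t - x))) 0.
Proof.
rewrite /vcons !mul_col_mx !mul_row_col mul0mx mulNmx mul_scalar_mx.
rewrite scalerBr scalerDr; congr (col_mx (col_mx (_ + _) (_ - _)) _);
by apply/matrixP => i j; rewrite !mxE big_ord1 !mxE.
Qed.

Lemma mul_net_tailE (R : realType) (d : nat) (d_gt0 : (0 < d)%N)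
    (a : R -> R) (k : nat) (g : R) (v w s : 'cV[R]_d) :
  (forall x, a x = Num.max x 0) ->
  ann_realization a (mul_net_tail d_gt0 k g)
    (map_mx a (split_mx R _ *m (col_mx (col_mx v w) s))) =
  g *: (s + map_mx (sq_interp k) v - map_mx (sq_interp k) w).
Proof.
move=> aE; elim: k g v w s => [|k IH] g v w s /=.
  rewrite addr0 -scalemxAl read_mxP // !map_col_mx !mul_row_col !mul0mx !mul1mx.
  rewrite add0r addr0 mulNmx mul1mx addrA; congr (_ *: (_ + _ - _)).
rewrite -mulmxA -mulmxDr read_mxP // !map_col_mx !mul_block_col.
rewrite !mul0mx !add0r !addr0 mul_row_col !mul_scalar_mx mulNmx mul_scalar_mx.
rewrite add_col_mx add0r scale_col_mx add_col_mx addr0.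
(* The bias is cut into its v and w halves to give the state the shape required by [IH]. *)
rewrite -(vsubmxK (const_mx (-1) : 'cV_(d + d))) add_col_mx IH.
(* The constants -1/4 of the two recursions cancel, so the accumulator needs no bias. *)
by apply/matrixP => i j; rewrite !mxE; field.
Qed.

Lemma mul_netE (R : realType) (d : nat) (d_gt0 : (0 < d)%N)
    (a : R -> R) (k : nat) (A t : R) (x : 'cV[R]_d) :
  (forall x, a x = Num.max x 0) ->
  ann_realization a (mul_net d_gt0 k A) (vcons t x) =
  \col_i approx_mul k A t (x i 0).
Proof.
move=> aE; rewrite /= addr0 -mulmxA polar_mxE mul_net_tailE //.
by apply/matrixP => i j; rewrite ord1 !mxE add0r.
Qed.

Lemma mul_net_tail_length (R : realType) (d : nat) (d_gt0 : (0 < d)%N)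
    (k : nat) (g : R) :
  ann_length (mul_net_tail d_gt0 k g) = k.+1.
Proof. by elim: k g => [|k IH] g //=; rewrite IH. Qed.

Lemma mul_net_tail_nparams (R : realType) (d : nat) (d_gt0 : (0 < d)%N)
    (k : nat) (g : R) :
  ann_nparams (mul_net_tail d_gt0 k g) =
  (k * (6 * d * (6 * d + 1)) + d * (6 * d + 1))%N.
Proof.
have e : (d + d + d + (d + d + d) = 6 * d)%N by lia.
by elim: k g => [|k IH] g /=; rewrite ?IH e ?mul0n // mulSn addnA.
Qed.

(** As d <= d^2, the first layer costs 6d(d + 2) <= 18 d^2, each step 6d(6d + 1) <= 42 d^2, and the
    output d(6d + 1) <= 7 d^2. *)
Lemma mul_net_nparams_le (R : realType) (d : nat) (d_gt0 : (0 < d)%N)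
    (k : nat) (A : R) :
  (ann_nparams (mul_net d_gt0 k A) <= d ^ 2 * (42 * k + 25))%N.
Proof.
by rewrite /= mul_net_tail_nparams; nia.
Qed.

(** * Choice of the radius and the depth *)

Definition clip_radius (R : realType) (eps q : R) : R := eps `^ (- (q - 2)^-1).

(** Dividing by r^2 leaves 1/eps <= r^(q-2), an equality at the clip radius. *)
Lemma sqr_le_powR (R : realType) (eps q r : R) : 0 < eps -> 2 < q ->
  clip_radius eps q <= r -> r ^+ 2 <= eps * r `^ q.
Proof.
move=> eps0 q2 Ar; have A0 : 0 < clip_radius eps q by apply: powR_gt0.
have r0 : 0 < r by apply: lt_le_trans Ar.
rewrite (powR_split2 q2 (ltW r0)) mulrA ler_peMl ?sqr_ge0 //.
rewrite -ler_pdivrMl // mulr1.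
suff <- : clip_radius eps q `^ (q - 2) = eps^-1.
  by rewrite ge0_ler_powR ?nnegrE ?(ltW r0) ?(ltW A0) //; lra.
by rewrite -powRrM mulNr mulVf ?powR_inv1 ?(ltW eps0) //; lra.
Qed.

(** Since 2/(q-2) + 1 = q/(q-2), taking logarithms turns the claim into q/(q-2) log2 (1/eps) <= 2
    (k+1). *)
Lemma clip_radius_le (R : realType) (eps q : R) (k : nat) : 0 < eps -> 2 < q ->
  q / (q - 2) * log2 eps^-1 < k.+1%:R ->
  clip_radius eps q ^+ 2 / 4 ^+ k.+1 <= eps.
Proof.
move=> eps0 q2 lk; have A0 : 0 < clip_radius eps q by apply: powR_gt0.
have p4 : 0 < 4 ^+ k.+1 :> R by rewrite exprn_gt0.
rewrite ler_pdivrMr // -ler_ln ?posrE ?mulr_gt0 ?exprn_gt0 //.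
rewrite lnXn // (@lnM _ eps) ?posrE // lnXn // ln_powR.
have ln2 : 0 < ln (2 : R) by apply: ln_gt0; lra.
have -> : ln (4 : R) = 2 * ln 2.
  by rewrite (_ : 4 = 2 ^+ 2) ?lnXn ?mulr_natl //; ring.
move: lk; rewrite /log2 lnV ?posrE // [q / _ * (_ / _)]mulrA ltr_pdivrMr //.
rewrite -[_ * ln 2 *+ _]mulr_natl -[_ * ln eps *+ _]mulr_natl.
have -> : q / (q - 2) * - ln eps = 2 * (- (q - 2)^-1 * ln eps) - ln eps.
  by field; lra.
have : 0 <= k.+1%:R * ln (2 : R) by rewrite mulr_ge0 // ltW.
move: (- (q - 2)^-1 * ln eps) (k.+1%:R) => u v; lra.
Qed.

(** An error of at most eps is paid for by the 1 in the maximum; otherwise r^2 <= eps r^q, and r^q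
    is |t|^q or |y|^q. *)
Lemma approx_mul_error (R : realType) (eps q : R) (k : nat) (t y : R) :
  0 < eps -> 2 < q -> q / (q - 2) * log2 eps^-1 < k.+1%:R ->
  `|t * y - approx_mul k (clip_radius eps q) t y| <=
    eps * (Num.max 1 (`|t| `^ q) + `|y| `^ q).
Proof.
move=> eps0 q2 lk; set M := Num.max 1 _.
have M1 : 1 <= M by rewrite le_max lexx.
have Mt : `|t| `^ q <= M by rewrite le_max lexx orbT.
have [h|[Ar h]] := approx_mulP k t y (powR_gt0 (- (q - 2)^-1) eps0).
  apply: le_trans (le_trans h (clip_radius_le eps0 q2 lk)) _.
  by rewrite ler_peMr ?(ltW eps0) // (le_trans M1) // lerDl powR_ge0.
apply: le_trans (le_trans h (sqr_le_powR eps0 q2 Ar)) _.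
rewrite ler_pM2l //; case: (leP `|t| `|y|) => _.
  by rewrite lerDr (le_trans ler01).
by apply: le_trans Mt _; rewrite lerDl powR_ge0.
Qed.

(** The error is at most 1 or r^2, hence at most 1 + t^2 + y^2, and |t y| <= (t^2 + y^2) / 2. *)
Lemma approx_mul_bound (R : realType) (eps q : R) (k : nat) (t y : R) :
  0 < eps -> eps <= 1 -> 2 < q -> q / (q - 2) * log2 eps^-1 < k.+1%:R ->
  `|approx_mul k (clip_radius eps q) t y| <= 1 + 2 * t ^+ 2 + 2 * y ^+ 2.
Proof.
move=> eps0 eps1 q2 lk; set z := approx_mul _ _ _ _.
have tyz : `|t * y - z| <= 1 + t ^+ 2 + y ^+ 2.
  have [h|[_ h]] := approx_mulP k t y (powR_gt0 (- (q - 2)^-1) eps0).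
    have := le_trans h (clip_radius_le eps0 q2 lk); rewrite -/z.
    by move: `|_ - _| => u; nra.
  apply: le_trans h _; have := sqr_ge0 t; have := sqr_ge0 y.
  by case: (leP `|t| `|y|) => _; rewrite real_normK ?num_real //; lra.
have : `|t * y| <= 2^-1 * (t ^+ 2 + y ^+ 2).
  rewrite ler_norml; have := sqr_ge0 (t - y); have := sqr_ge0 (t + y); nra.
have := ler_distD (t * y) z 0; rewrite !subr0 distrC.
move: tyz; move: `|z| `|_ - _| `|_ * _| => a b c; nra.
Qed.

(** The gap q^2 - 8 (q - 2) is (q - 4)^2. This bound absorbs the additive constants in the length
    and the parameter count. *)
Lemma sqr_div_sub2_ge8 (R : realFieldType) (q : R) : 2 < q ->
  8 <= q / (q - 2) * q.
Proof.
move=> q2; have -> : q / (q - 2) * q = q ^+ 2 / (q - 2) by ring.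
by rewrite ler_pdivlMr ?subr_gt0 //; have := sqr_ge0 (q - 4); lra.
Qed.

Theorem proposition3p7 (R : realType) (eps q : R) (d : nat) (a : R -> R)
    (eps_gt0 : 0 < eps) (eps_le1 : eps <= 1) (q_gt2 : 2 < q)
    (d_gt0 : (0 < d)%N)
    (a_cont : continuous a) (aE : forall x : R, a x = Num.max x 0) :
  exists Phi : ann R d.+1 d,
    continuous (ann_realization a Phi) /\
    (forall (t : R) (x : 'cV[R]_d),
       ann_realization a Phi (vcons t 0) = 0 /\
       ann_realization a Phi (vcons 0 x) = 0) /\
    (forall (t : R) (x : 'cV[R]_d),
       enorm (t *: x - ann_realization a Phi (vcons t x)) <=
       eps * (Num.sqrt d%:R * Num.max 1 (`|t| `^ q) + enorm x `^ q)) /\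
    (forall (t : R) (x : 'cV[R]_d),
       enorm (ann_realization a Phi (vcons t x)) <=
       Num.sqrt d%:R * (1 + 2 * t ^+ 2) + 2 * enorm x ^+ 2) /\
    (ann_nparams Phi)%:R <=
      d%:R ^+ 2 * (360 * q / (q - 2)) * (log2 eps^-1 + q + 1)
      - 252 * d%:R ^+ 2 /\
    (ann_length Phi)%:R <= q / (q - 2) * (log2 eps^-1 + q).
Proof.
(* Truncation serves both ends: k <= lam bounds the size, and lam < k + 1 bounds the error. *)
set lam := q / (q - 2) * log2 eps^-1; set k := Num.truncn lam.
have c1 : 1 <= q / (q - 2) by rewrite ler_pdivlMr ?subr_gt0 //; lra.
have c8 := sqr_div_sub2_ge8 q_gt2.
have lam0 : 0 <= lam.
  apply: mulr_ge0; first exact: le_trans ler01 c1.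
  by rewrite divr_ge0 ?ln_ge0 ?invf_ge1 ?ler1n.
have klam : k%:R <= lam by rewrite /k truncn_le.
have lamk : lam < k.+1%:R by apply: truncnS_gt.
exists (mul_net d_gt0 k (clip_radius eps q)).
split; first exact: ann_realization_continuous.
split=> [t x|].
  by split; rewrite mul_netE //; apply/matrixP => i j;
    rewrite !mxE ?approx_mul0r ?approx_mul0l.
split=> [t x|].
  rewrite mul_netE // mulrDr mulrCA.
  apply: le_trans (enorm_le (M := eps * Num.max 1 (`|t| `^ q))
    (b := \col_i (eps * `|x i 0| `^ q)) d_gt0 _ _ _) _.
  - by rewrite mulr_ge0 ?(ltW eps_gt0) ?le_max ?ler01.
  - by move=> i; rewrite mxE mulr_ge0 ?powR_ge0 ?(ltW eps_gt0).
  - by move=> i; rewrite !mxE -mulrDr; apply: approx_mul_error.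
  rewrite lerD2l; under eq_bigr do rewrite mxE.
  by rewrite -mulr_sumr ler_pM2l // sum_powR_le.
split=> [t x|].
  rewrite mul_netE // sqr_enorm mulr_sumr.
  apply: le_trans (enorm_le (M := 1 + 2 * t ^+ 2)
    (b := \col_i (2 * x i 0 ^+ 2)) d_gt0 _ _ _) _.
  - by have := sqr_ge0 t; lra.
  - by move=> i; rewrite mxE mulr_ge0 ?sqr_ge0.
  - by move=> i; rewrite !mxE; apply: approx_mul_bound.
  by rewrite lerD2l; under eq_bigr do rewrite mxE.
split; last first.
  (* The length is k + 2: k steps, the polarising layer and the output. *)
  rewrite /= mul_net_tail_length mulrDr -/lam -addn2 natrD; lra.
apply: (@le_trans _ _ (d ^ 2 * (42 * k + 25))%:R).
  by rewrite ler_nat mul_net_nparams_le.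
have -> : d%:R ^+ 2 * (360 * q / (q - 2)) * (log2 eps^-1 + q + 1) -
    252 * d%:R ^+ 2 =
    d%:R ^+ 2 * (360 * (lam + q / (q - 2) * q + q / (q - 2)) - 252) :> R.
  by rewrite /lam; ring.
rewrite natrM natrX natrD natrM ler_wpM2l ?sqr_ge0 //; lra.
Qed.
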